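(* Let $R$ be a strong Mori domain. The following statements are equivalent: (i) $R$ is Clifford $w$-regular (respectively, Boole $w$-regular); (ii) $R$ is $w$-stable (respectively, strongly $w$-stable).
   Context: Let $R$ be an integral domain with field of fractions $K$. An ideal of $R$ means a nonzero fractional ideal; it is integral if it is contained in $R$. For $R$-submodules $I,J$ of $K$, $(J:I):=\{x\in K: xI\subseteq J\}$. For an ideal $I$: $I^v:=(R:(R:I))$; $I^t:=\bigcup\{J^v : J\subseteq I \text{ a finitely generated ideal}\}$; $I^w:=\bigcap_{M\in t\text{-}\mathrm{Max}(R)}IR_M$, where $t\text{-}\mathrm{Max}(R)$ is the set of maximal elements among the proper integral ideals with $I=I^t$ (they are prime). A $w$-ideal is an ideal with $I=I^w$. $R$ is strong Mori if it satisfies the ascending chain condition on integral $w$-ideals. An ideal $I$ of $R$ is: (Clifford) $w$-regular if $I^w=(I^2J)^w$ for some ideal $J$ of $R$; Boole $w$-regular if $(I^2)^w=xI^w$ for some $0\neq x\in K$; $w$-stable if, with $E:=(I^w:I^w)$, $(I^w(E:I^w))^w=E$ ($w$ being the operation of $R$; fractional ideals of $E$ are fractional ideals of $R$); strongly $w$-stable if $I^w=xE$ for some $x\in K$, with $E=(I^w:I^w)$. $R$ is Clifford $w$-regular, Boole $w$-regular, $w$-stable, strongly $w$-stable if every ideal of $R$ has the corresponding property. *)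

(* Defs.v *)
From mathcomp Require Import all_boot all_order all_algebra.
From mathcomp Require Import boolp classical_sets.

Set Implicit Arguments.
Unset Strict Implicit.
Unset Printing Implicit Defensive.

Import GRing.Theory.
Local Open Scope classical_set_scope.
Local Open Scope ring_scope.

Local Notation "x %:F" := (@FracField.tofrac _ x).

(** Fractional ideals of an integral domain [R] are represented as subsets of
    its field of fractions [{fraction R}]. *)

Section FractionalIdeals.
Variable R : idomainType.
Local Notation K := {fraction R}.
Implicit Types I J M A : set K.

Definition base : set K := range (@FracField.tofrac R).

Definition submodule I : Prop :=
  [/\ I 0,
      forall x y, I x -> I y -> I (x + y)
    & forall (a : R) x, I x -> I (a%:F * x)].

Definition is_ideal I : Prop :=
  [/\ submodule I,
      exists2 x, I x & x != 0
    & exists2 d : R, d != 0 & forall x, I x -> base (d%:F * x)].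

Definition integral I : Prop := I `<=` base.

Definition span (s : seq K) : set K :=
  [set x | exists c : 'I_(size s) -> R, x = \sum_(i < size s) (c i)%:F * s`_i].

Definition fin_gen I : Prop := exists s : seq K, I = span s.

Definition idmul I J : set K :=
  [set x | exists n (a b : 'I_n -> K),
    [/\ forall i, I (a i), forall i, J (b i) & x = \sum_(i < n) a i * b i]].

Definition idscale (x : K) I : set K := [set x * y | y in I].

(** [colon J I] is (J : I), computed in the field of fractions. *)
Definition colon J I : set K := [set x | idscale x I `<=` J].

Definition v_op I : set K := colon base (colon base I).

Definition t_op I : set K :=
  \bigcup_(J in [set J | [/\ is_ideal J, fin_gen J & J `<=` I]]) v_op J.

Definition proper_t_ideal I : Prop :=
  [/\ is_ideal I, integral I, I <> base & I = t_op I].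

Definition t_Max : set (set K) :=
  [set M | proper_t_ideal M /\
    forall N, proper_t_ideal N -> M `<=` N -> N = M].

Definition localization M : set K :=
  [set a / s | a in base & s in base `\` M].

(** If [R] is a field then [t_Max] is empty and [w_op I] is the whole field of
    fractions, i.e. [R] itself. *)
Definition w_op I : set K := \bigcap_(M in t_Max) idmul I (localization M).

Definition w_ideal I : Prop := is_ideal I /\ I = w_op I.

Definition clifford_w_regular I : Prop :=
  exists2 J, is_ideal J & w_op I = w_op (idmul (idmul I I) J).

Definition boole_w_regular I : Prop :=
  exists2 x : K, x != 0 & w_op (idmul I I) = idscale x (w_op I).

Definition w_stable I : Prop :=
  let E := colon (w_op I) (w_op I) in
  w_op (idmul (w_op I) (colon E (w_op I))) = E.

Definition strongly_w_stable I : Prop :=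
  let E := colon (w_op I) (w_op I) in
  exists x : K, w_op I = idscale x E.

End FractionalIdeals.

Definition strong_Mori (R : idomainType) : Prop :=
  forall I : nat -> set {fraction R},
    (forall n, w_ideal (I n) /\ integral (I n)) ->
    (forall n, I n `<=` I n.+1) ->
    exists N, forall n, (N <= n)%N -> I n = I N.

Definition clifford_w_regular_domain (R : idomainType) : Prop :=
  forall I : set {fraction R}, is_ideal I -> clifford_w_regular I.

Definition boole_w_regular_domain (R : idomainType) : Prop :=
  forall I : set {fraction R}, is_ideal I -> boole_w_regular I.

Definition w_stable_domain (R : idomainType) : Prop :=
  forall I : set {fraction R}, is_ideal I -> w_stable I.

Definition strongly_w_stable_domain (R : idomainType) : Prop :=
  forall I : set {fraction R}, is_ideal I -> strongly_w_stable I.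

(* Main.v *)
(** The [w]-closure is tested at the t-maximal ideals [M], which are prime: [x]
    lies in [I^w] iff for every [M] some [s] in [R] outside [M] sends [x] into
    [I]. By strong Mori, [I] is contained in [F^w] for a finitely generated
    [F] contained in [I]. If [I^w = (I^2 J)^w], then locally at [M] the
    finitely generated module [I] is absorbed by [I J], which is closed under
    products, so Nakayama's lemma puts [1] in the localization of [I J]; hence
    [1] lies in [(I J)^w]. As [I J] is contained in [E = (I^w : I^w)] and [J] in
    [(E : I^w)], this is [w]-stability. In the Boole case
    [(I^2)^w = x I^w] one takes [J = x^-1 R]: then [x] lies in [I^w] and
    [I^w = x E]. The converses are direct, with [J = (E : I^w)]. *)

Require Import Defs.
From mathcomp Require Import all_boot all_algebra.
From mathcomp Require Import boolp classical_sets ring.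

Set Implicit Arguments.
Unset Strict Implicit.
Unset Printing Implicit Defensive.

Import GRing.Theory.
Local Open Scope classical_set_scope.
Local Open Scope ring_scope.

Local Notation "x %:F" := (@FracField.tofrac _ x).

(* [span] alone would denote the linear span of [vector]. *)
Local Notation span := (@Defs.span _).

(** * Submodules of the fraction field, products of subsets, and Nakayama's lemma *)

Section Submodules.
Variable R : idomainType.
Local Notation K := {fraction R}.
Local Notation base := (@base R).
Implicit Types (I J X P : set K) (x y : K).

Lemma base0 : base 0.
Proof. by exists 0; rewrite ?tofrac0. Qed.

Lemma base1 : base 1.
Proof. by exists 1; rewrite ?tofrac1. Qed.

Lemma baseD x y : base x -> base y -> base (x + y).
Proof. by move=> [a _ <-] [b _ <-]; exists (a + b); rewrite ?tofracD. Qed.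

Lemma baseM x y : base x -> base y -> base (x * y).
Proof. by move=> [a _ <-] [b _ <-]; exists (a * b); rewrite ?tofracM. Qed.

Lemma base_tofrac (a : R) : base a%:F.
Proof. by exists a. Qed.

Lemma base_submodule : submodule base.
Proof.
by split=> [|x y|a x]; [exact: base0 | exact: baseD | exact/baseM/base_tofrac].
Qed.

Lemma fraction_denom x : exists2 d : R, d != 0 & base (d%:F * x).
Proof.
elim/quotW: x => r; exists (\d_r); first exact: denom_ratioP.
exists (\n_r) => //; unlock FracField.tofrac.
rewrite -[RHS]FracField.pi_mul; apply/eqmodP.
by rewrite /= FracField.equivfE /FracField.mulf !numden_Ratio
  ?(oner_neq0, mul1r, mulf_neq0, denom_ratioP) //= mulrC.
Qed.

(** Weaker than [submodule] so that it holds for [idmul] of arbitrary subsets, for instance the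
    entries of a list. *)
Definition add_closed X := X 0 /\ forall x y, X x -> X y -> X (x + y).

Lemma submodule_add I : submodule I -> add_closed I.
Proof. by case. Qed.

Lemma submoduleZ I r x : submodule I -> base r -> I x -> I (r * x).
Proof. by move=> [_ _ IZ] [a _ <-]; exact: IZ. Qed.

Lemma idscaleE x I y : x != 0 -> idscale x I y <-> I (x^-1 * y).
Proof.
move=> x0; split=> [[z Iz <-]|Iy]; first by rewrite mulKf.
by exists (x^-1 * y) => //; rewrite mulVKf.
Qed.

Lemma idscale_submodule x I : submodule I -> submodule (idscale x I).
Proof.
move=> [I0 ID IZ]; split=> [|_ _ [y Iy <-] [z Iz <-]|a _ [y Iy <-]].
- by exists 0; rewrite ?mulr0.
- by exists (y + z); [exact: ID | rewrite mulrDr].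
- by exists (a%:F * y); [exact: IZ | rewrite mulrCA].
Qed.

Lemma colonE J I x : colon J I x <-> forall y, I y -> J (x * y).
Proof.
split=> [h y Iy|h _ [y Iy <-]]; last exact: h.
by apply: h; exists y.
Qed.

Lemma colon_submodule J I : submodule J -> submodule (colon J I).
Proof.
move=> [J0 JD JZ]; split=> [|x y /colonE hx /colonE hy|a x /colonE hx];
  apply/colonE => z Iz.
- by rewrite mul0r.
- by rewrite mulrDl; apply: JD; [exact: hx | exact: hy].
- by rewrite -mulrA; apply/JZ/hx.
Qed.

Lemma idmul_add I J : add_closed (idmul I J).
Proof.
split=> [|_ _ [n [a [b [Ia Jb ->]]]] [m [c [d [Ic Jd ->]]]]].
  by exists 0%N, (fun=> 0), (fun=> 0); split; rewrite ?big_ord0 // => -[].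
exists (n + m)%N, (fun i => match split i with inl j => a j | inr j => c j end),
  (fun i => match split i with inl j => b j | inr j => d j end); split.
- by move=> i; case: (split i).
- by move=> i; case: (split i).
rewrite big_split_ord /=; congr (_ + _); apply: eq_bigr => i _.
  by rewrite -[lshift _ _]/(unsplit (inl i)) unsplitK.
by rewrite -[rshift _ _]/(unsplit (inr i)) unsplitK.
Qed.

Lemma idmul_prod I J x y : I x -> J y -> idmul I J (x * y).
Proof.
by move=> Ix Jy; exists 1%N, (fun=> x), (fun=> y); split; rewrite ?big_ord1.
Qed.

(** The induction principle for products: an additive property need only be checked on single
    products [x * y]. *)
Lemma idmul_sub I J X : add_closed X ->
  (forall x y, I x -> J y -> X (x * y)) -> idmul I J `<=` X.
Proof.
move=> [X0 XD] XM _ [n [a [b [Ia Jb ->]]]]; elim/big_ind: _ => // i _.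
exact: XM.
Qed.

Lemma add_closed_mul X c : add_closed X -> add_closed [set x | X (c * x)].
Proof.
by move=> [X0 XD]; split=> [|x y Xx Xy] /=; rewrite ?mulr0 // mulrDr; exact: XD.
Qed.

(** The scalar [c] may lie outside [base]. This covers multiplication by elements of [P], by
    inverses of denominators and by elements of [E]. *)
Lemma idmulZ I J c x :
  (forall y, I y -> I (c * y)) -> idmul I J x -> idmul I J (c * x).
Proof.
move=> Ic; move: x; apply: idmul_sub; first exact/add_closed_mul/idmul_add.
by move=> x y Ix Jy /=; rewrite mulrA; apply: idmul_prod => //; exact: Ic.
Qed.

Lemma idmul_submodule I J : submodule I -> submodule (idmul I J).
Proof.
move=> sI; have [m0 mD] := idmul_add I J; split=> // a x.
by apply: idmulZ => y; apply: submoduleZ => //; exact: base_tofrac.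
Qed.

Lemma spanE (s : seq K) : span s = idmul base [set` s].
Proof.
apply/seteqP; split=> [_ [c ->]|].
  have [m0 mD] := idmul_add base [set` s].
  elim/big_ind: _ => // i _; apply: idmul_prod; first exact: base_tofrac.
  exact: mem_nth.
apply: idmul_sub.
  split=> [|_ _ [c ->] [d ->]].
    by exists (fun=> 0); rewrite big1 // => i _; rewrite tofrac0 mul0r.
  exists (fun i => c i + d i); rewrite -big_split /=.
  by apply: eq_bigr => i _; rewrite tofracD mulrDl.
move=> _ y [a _ <-] /= ys; have ls : (index y s < size s)%N by rewrite index_mem.
exists (fun i => if i == Ordinal ls then a else 0).
rewrite (bigD1 (Ordinal ls)) //= eqxx nth_index // big1 ?addr0 // => i.
by move=> /negPf ->; rewrite tofrac0 mul0r.
Qed.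

Lemma span_submodule (s : seq K) : submodule (span s).
Proof. by rewrite spanE; apply/idmul_submodule/base_submodule. Qed.

Lemma mem_span (s : seq K) x : x \in s -> span s x.
Proof.
by move=> xs; rewrite spanE -[x]mul1r; apply: idmul_prod => //; exact: base1.
Qed.

Lemma span_sub (s : seq K) I : submodule I -> [set` s] `<=` I -> span s `<=` I.
Proof.
move=> sI sub; rewrite spanE; apply: idmul_sub; first exact: submodule_add.
by move=> r y br ys; apply: submoduleZ => //; exact: sub.
Qed.

Lemma idscale_span x (s : seq K) :
  idscale x (span s) = span [seq x * y | y <- s].
Proof.
apply/seteqP; split=> [_ [y sy <-]|].
  move: y sy; apply: (@span_sub s [set y | span _ (x * y)]).
    have [S0 SD SZ] := span_submodule [seq x * y | y <- s].
    split=> [|y z Sy Sz|a y Sy] /=; first by rewrite mulr0.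
      by rewrite mulrDr; exact: SD.
    by rewrite mulrCA; exact: SZ.
  by move=> y ys /=; apply/mem_span/map_f.
apply: span_sub; first exact/idscale_submodule/span_submodule.
by move=> _ /mapP[y ys ->]; exists y => //; exact: mem_span.
Qed.

(** [P] may fail to contain [1], so this is Nakayama's lemma for a module
    absorbed by the non-unital ring [P]; generators are eliminated one by one,
    up to multipliers [u] in [1 + P]. *)
Lemma nakayama P (PD : add_closed P) (PN : forall x, P x -> P (- x))
    (PM : forall x y, P x -> P y -> P (x * y)) (s : seq K) (T : set K) u :
  P (1 - u) -> [set` s] `<=` T -> (exists2 f, T f & f != 0) ->
  (forall f, T f -> idmul P [set` s] (u * f)) -> P 1.
Proof.
case: (PD) => P0 PA.
elim: s u => [|f0 s IH] u Pu sT [g Tg g0] hT.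
  (* Without generators, [u * g = 0] with [g] nonzero, so [u = 0] and [1 - u] is 1. *)
  have /(_ _ (hT g Tg)) : idmul P [set` [::]] `<=` [set 0].
    by apply: idmul_sub => //; split=> //= x y -> ->; rewrite addr0.
  move=> /eqP; rewrite mulf_eq0 (negPf g0) orbF => /eqP u0.
  by move: Pu; rewrite u0 subr0.
have dec x : idmul P [set` f0 :: s] x ->
    exists2 a, P a & idmul P [set` s] (x - a * f0).
  have [m0 mD] := idmul_add P [set` s].
  move: x; apply: idmul_sub.
    split; first by exists 0; rewrite // mul0r subr0.
    move=> x y [a Pa xa] [b Pb yb]; exists (a + b); first exact: PA.
    by rewrite mulrDl opprD addrACA; exact: mD.
  move=> a y Pa; rewrite /= inE => /orP[/eqP ->|ys].
    by exists a; rewrite // subrr.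
  by exists 0; rewrite // mul0r subr0; exact: idmul_prod.
have [a0 Pa0 y0] := dec _ (hT f0 (sT f0 (mem_head _ _))).
(* Applied to [f0] itself, the hypothesis puts [v * f0] in the part generated by [s]; multiplying by
   [v] thus eliminates [f0]. *)
pose v := u - a0; have Pv : P (1 - v).
  by rewrite /v opprB addrCA addrC; exact: PA.
rewrite -mulrBl -/v in y0.
apply: (IH (v * u)) => //.
- have -> : 1 - v * u = (1 - v) + ((1 - u) - (1 - v) * (1 - u)) by ring.
  by apply/PA/PA/PN/PM.
- by move=> y ys; apply: sT; rewrite /= inE ys orbT.
- by exists g.
move=> f Tf; have [a Pa yf] := dec _ (hT f Tf).
have [m0 mD] := idmul_add P [set` s].
have mZ c y : P c -> idmul P [set` s] y -> idmul P [set` s] (c * y).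
  by move=> Pc; apply: idmulZ => z; exact: PM.
have mN y : idmul P [set` s] y -> idmul P [set` s] (- y).
  by rewrite -mulN1r; apply: idmulZ => z; rewrite mulN1r; exact: PN.
(* Only [1 - v] is known to lie in [P], so multiplication by [v] is written as [y - (1 - v) * y]. *)
have -> : v * u * f = a * (v * f0)
    + ((u * f - a * f0) - (1 - v) * (u * f - a * f0)) by ring.
by apply: (mD); [exact: mZ | apply/mD/mN/mZ].
Qed.

End Submodules.

(** * t-ideals, t-maximal ideals and the local criterion for the w-closure *)

Section TMaximal.
Variable R : idomainType.
Local Notation K := {fraction R}.
Local Notation base := (@base R).
Implicit Types (I J M : set K) (x y : K).

Lemma v_op_base I : I `<=` base -> v_op I `<=` base.
Proof.
move=> Ib x /colonE h; rewrite -[x]mulr1; apply: h; apply/colonE => y Iy.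
by rewrite mul1r; exact: Ib.
Qed.

Lemma t_op_sup I : is_ideal I -> I `<=` t_op I.
Proof.
move=> [sI [c Ic c0] [d d0 dI]] x Ix.
have scI : [set` [:: x; c]] `<=` I.
  by move=> y; rewrite /= !inE => /orP[] /eqP ->.
(* The nonzero generator [c] makes the span an ideal even when [x] is 0. *)
exists (span [:: x; c]); last first.
  apply/colonE => y /colonE hy; rewrite mulrC; apply: hy.
  exact/mem_span/mem_head.
split; [split | by exists [:: x; c] | exact: span_sub].
- exact: span_submodule.
- by exists c => //; apply: mem_span; rewrite !inE eqxx orbT.
- by exists d => // y /(span_sub sI scI); exact: dI.
Qed.

Lemma integral_ideal I x : submodule I -> integral I -> I x -> x != 0 ->
  is_ideal I.
Proof.
move=> sI iI Ix x0; split=> //; first by exists x.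
by exists 1; rewrite ?oner_neq0 // => y /iI; rewrite tofrac1 mul1r.
Qed.

Lemma proper_t_idealP I : proper_t_ideal I ->
  [/\ submodule I, I `<=` base, ~ I 1 &
    forall J, is_ideal J -> fin_gen J -> J `<=` I -> v_op J `<=` I].
Proof.
move=> [[sI _ _] iI I1 tI]; split=> // [I_1|J iJ fJ JI x vx].
  apply: I1; apply/seteqP; split=> // x bx.
  by rewrite -[x]mulr1; exact: submoduleZ.
by rewrite tI; exists J.
Qed.

Lemma proper_t_ideal_intro I x : submodule I -> I `<=` base -> ~ I 1 ->
  I x -> x != 0 ->
  (forall J, is_ideal J -> fin_gen J -> J `<=` I -> v_op J `<=` I) ->
  proper_t_ideal I.
Proof.
move=> sI Ib I1 Ix x0 h; have iI := integral_ideal sI Ib Ix x0.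
split=> //; first by move=> Ie; apply: I1; rewrite Ie; exact: base1.
apply/seteqP; split; first exact: t_op_sup.
by move=> y [J [iJ fJ JI]]; exact: h.
Qed.

(** The t-operation has finite character: finitely many generators in the union of a chain already
    lie in one member, which then contains the v-closure. *)
Lemma chain_proper_t_ideal (F : set (set K)) :
  F !=set0 -> F `<=` @proper_t_ideal R -> total_on F subset ->
  proper_t_ideal (\bigcup_(X in F) X).
Proof.
move=> [A FA] Fp Ft; have [[[A0 _ _] [c Ac c0] _] _ _ _] := Fp A FA.
have sub2 X Y : F X -> F Y -> exists2 Z, F Z & X `<=` Z /\ Y `<=` Z.
  by move=> FX FY; case: (Ft X Y FX FY) => h; [exists Y | exists X] => //;
    split=> // ?.
apply: (@proper_t_ideal_intro _ c) => //.
- split=> [|x y [X FX Xx] [Y FY Yy]|a x [X FX Xx]]; first by exists A.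
    have [Z FZ [XZ YZ]] := sub2 X Y FX FY; exists Z => //.
    have [[_ ZD _] _ _ _] := proper_t_idealP (Fp Z FZ).
    by apply: ZD; [exact: XZ | exact: YZ].
  exists X => //; have [[_ _ XZ] _ _ _] := proper_t_idealP (Fp X FX).
  exact: XZ.
- by move=> x [X FX Xx]; have [_ Xb _ _] := proper_t_idealP (Fp X FX); exact: Xb.
- by move=> [X FX X1]; have [] := proper_t_idealP (Fp X FX).
- by exists A.
move=> J iJ [s Js] JU.
have {JU} : [set` s] `<=` \bigcup_(X in F) X.
  by move=> y ys; apply: JU; rewrite Js; exact: mem_span.
suff h : [set` s] `<=` \bigcup_(X in F) X -> exists2 X, F X & [set` s] `<=` X.
  move=> /h[X FX sX]; have [sbX _ _ vX] := proper_t_idealP (Fp X FX).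
  move=> x vx; exists X => //; apply: (vX J) => //; first by exists s.
  by rewrite Js; exact: span_sub.
elim: s {Js} => [|f s IH] sU; first by exists A.
have [X FX sX] : exists2 X, F X & [set` s] `<=` X.
  by apply: IH => y ys; apply: sU; rewrite /= inE ys orbT.
have [Y FY Yf] := sU f (mem_head _ _).
have [Z FZ [XZ YZ]] := sub2 X Y FX FY; exists Z => // y.
by rewrite /= inE => /orP[/eqP ->|/sX/XZ//]; exact: YZ.
Qed.

Lemma proper_t_ideal_t_Max I :
  proper_t_ideal I -> exists2 M, t_Max M & I `<=` M.
Proof.
move=> pI.
(* Taking the union with [I] keeps the empty chain harmless: its union yields [I] itself. *)
have [F FP Ft|X [pX maxX]] := @Zorn_bigcup K [set X | proper_t_ideal (I `|` X)].
  rewrite /=; have -> : I `|` \bigcup_(X in F) X =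
      \bigcup_(Y in I |` [set I `|` X | X in F]) Y.
    apply/seteqP; split=> [x [Ix|[X FX Xx]]|x [_ [->|[X FX <-]] xX]].
    - by exists I => //; left.
    - by exists (I `|` X); [right; exists X | right].
    - by left.
    - by case: xX; [left | right; exists X].
  apply: chain_proper_t_ideal; first by exists I; left.
    by move=> _ [->//|[X FX <-]]; exact: FP.
  move=> _ _ [->|[X FX <-]] [->|[Y FY <-]].
  - by left.
  - by left; exact: subsetUl.
  - by right; exact: subsetUl.
  - by case: (Ft X Y FX FY) => h; [left | right]; exact: setUS.
exists (I `|` X); last exact: subsetUl.
split=> // N pN XN; apply: contrapT => NX.
have IN : I `|` N = N by apply/setUidr => x Ix; apply: XN; left.
apply: (maxX N); last by rewrite /= IN.
split; first by move=> x Xx; apply: XN; right.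
move=> NsX; apply: NX; apply/seteqP; split=> // x Nx; right; exact: NsX.
Qed.

Lemma t_MaxP M : t_Max M -> [/\ submodule M, M `<=` base & ~ M 1].
Proof. by move=> [/proper_t_idealP[]]. Qed.

(** [(M : x) `&` R] is again a proper t-ideal containing [M]. *)
Lemma t_Max_prime M x y : t_Max M -> (base `\` M) x -> (base `\` M) y ->
  (base `\` M) (x * y).
Proof.
move=> tM [bx Mx] [b_y My]; split; first exact: baseM.
have [pM maxM] := tM; have [sM Mb M1 vM] := proper_t_idealP pM.
have [[_ [c Mc c0] _] _ _ _] := pM.
have [M0 MD MZ] := sM.
have x0 : x != 0 by apply/eqP => x0; apply: Mx; rewrite x0.
move=> Mxy; pose N := [set z | base z /\ M (x * z)].
suff NM : N = M by apply: My; rewrite -NM.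
apply: maxM; last by move=> z Mz; split; [exact: Mb | exact: submoduleZ].
apply: (@proper_t_ideal_intro _ c) => //.
- split=> [|z w [bz Mz] [bw Mw]|a z [bz Mz]].
  + by split; [exact: base0 | rewrite mulr0].
  + by split; [exact: baseD | rewrite mulrDr; exact: MD].
  + split; last by rewrite mulrCA; exact: MZ.
    exact/baseM/bz/base_tofrac.
- by move=> z [].
- by move=> [_]; rewrite mulr1.
- by split; [exact: Mb | exact: submoduleZ].
move=> J [sJ [e Je e0] _] [s Js] JN z vz; split.
  by apply: v_op_base vz => w /JN[].
(* Scaling commutes with the v-closure, so [x * z] lies in the v-closure of [idscale x J], a
   finitely generated ideal inside [M]. *)
apply: (vM (idscale x J)).
- apply: (@integral_ideal _ (x * e)).
  + exact: idscale_submodule.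
  + by move=> _ [w /JN[_ /Mb] ? <-].
  + by exists e.
  + exact: mulf_neq0.
- by exists [seq x * w | w <- s]; rewrite Js idscale_span.
- by move=> _ [w /JN[]] ? ? <-.
apply/colonE => w /colonE hw; rewrite -mulrA mulrCA.
move/colonE: vz; apply; apply/colonE => u Ju; rewrite -mulrA [w * u]mulrC.
rewrite mulrA [_ * w]mulrC.
by apply: hw; exists u.
Qed.

Lemma denom1 M : t_Max M -> (base `\` M) 1.
Proof. by move=> /t_MaxP[_ _ M1]; split=> //; exact: base1. Qed.

Lemma denom_neq0 M x : t_Max M -> (base `\` M) x -> x != 0.
Proof.
by move=> /t_MaxP[[M0 _ _] _ _] [_ Mx]; apply/eqP => x0; apply: Mx; rewrite x0.
Qed.

(** This set is the localization of [I] at [M] with denominators cleared; primality of [M] makes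
    [s * t] a common denominator. *)
Lemma local_add_closed I M : submodule I -> t_Max M ->
  add_closed [set x | exists2 s, (base `\` M) s & I (s * x)].
Proof.
move=> sI tM; have [I0 ID _] := sI.
split; first by exists 1; [exact: denom1 | rewrite mulr0].
move=> x y [s ds Isx] [t dt Ity]; exists (s * t); first exact: t_Max_prime.
rewrite mulrDr; apply: ID; last by rewrite -mulrA; apply: submoduleZ ds.1 _.
by rewrite mulrAC mulrC; apply: submoduleZ dt.1 _.
Qed.

(** Replaces sums over the localization by one multiplier per t-maximal ideal, the form in which the
    w-closure is handled from here on. *)
Lemma w_opP I x : submodule I ->
  w_op I x <-> forall M, t_Max M -> exists2 s, (base `\` M) s & I (s * x).
Proof.
move=> sI; split=> h M tM.
  have := h M tM; move: x {h}; apply: idmul_sub; first exact: local_add_closed.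
  move=> x _ Ix [a ba [s ds <-]]; exists s => //.
  rewrite mulrC -mulrA mulrVK ?unitfE; last exact: denom_neq0 ds.
  by rewrite mulrC; exact: submoduleZ.
have [s ds Isx] := h M tM.
rewrite -[x](mulKf (denom_neq0 tM ds)) mulrC.
apply: idmul_prod => //; exists 1; first exact: base1.
by exists s; rewrite ?mul1r.
Qed.

End TMaximal.

(** * Closure properties of the w-operation *)

Section WOperation.
Variable R : idomainType.
Local Notation K := {fraction R}.
Local Notation base := (@base R).
Implicit Types (I J M : set K) (x y : K).

Lemma w_op_sup I : submodule I -> I `<=` w_op I.
Proof.
move=> sI x Ix; apply/w_opP => // M tM; exists 1; first exact: denom1.
by rewrite mul1r.
Qed.

Lemma w_op_submodule I : submodule I -> submodule (w_op I).
Proof.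
move=> sI; have [I0 _ IZ] := sI; split.
- exact: w_op_sup.
- move=> x y /(w_opP _ sI) hx /(w_opP _ sI) hy; apply/w_opP => // M tM.
  have [_] := local_add_closed sI tM; apply; [exact: hx | exact: hy].
- move=> a x /(w_opP _ sI) hx; apply/w_opP => // M tM.
  by have [s ds Isx] := hx M tM; exists s => //; rewrite mulrCA; exact: IZ.
Qed.

Lemma w_op_least I J : submodule I -> submodule J ->
  I `<=` w_op J -> w_op I `<=` w_op J.
Proof.
move=> sI sJ IJ x /(w_opP _ sI) h; apply/w_opP => // M tM.
have [s ds /IJ/(w_opP _ sJ)/(_ M tM)[t dt Jts]] := h M tM.
by exists (t * s); [exact: t_Max_prime | rewrite -mulrA].
Qed.

Lemma w_op_mono I J : submodule I -> submodule J ->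
  I `<=` J -> w_op I `<=` w_op J.
Proof.
by move=> sI sJ IJ; apply: w_op_least => // x Ix; apply/w_op_sup/IJ.
Qed.

Lemma w_op_idem I : submodule I -> w_op (w_op I) = w_op I.
Proof.
move=> sI; have sw := w_op_submodule sI.
by apply/seteqP; split; [exact: w_op_least | exact: w_op_sup].
Qed.

Lemma w_op_idscale x I : x != 0 -> submodule I ->
  w_op (idscale x I) = idscale x (w_op I).
Proof.
move=> x0 sI; have sx := idscale_submodule x sI.
apply/seteqP; split=> y.
  move=> /(w_opP _ sx) h; apply/idscaleE/w_opP => // M tM.
  by have [s ds /(idscaleE _ _ x0)] := h M tM; rewrite mulrCA; exists s.
move=> /(idscaleE _ _ x0)/(w_opP _ sI) h; apply/w_opP => // M tM.
have [s ds h'] := h M tM; exists s => //.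
by apply/idscaleE => //; rewrite mulrCA.
Qed.

Lemma w_op_idmul I J : submodule I -> submodule J ->
  idmul (w_op I) (w_op J) `<=` w_op (idmul I J).
Proof.
move=> sI sJ; have sm := @idmul_submodule _ I J sI.
apply: idmul_sub; first exact/submodule_add/w_op_submodule.
move=> x y /(w_opP _ sI) hx /(w_opP _ sJ) hy; apply/w_opP => // M tM.
have [s ds Isx] := hx M tM; have [t dt Jty] := hy M tM.
exists (s * t); first exact: t_Max_prime.
by rewrite mulrACA; exact: idmul_prod.
Qed.

(** A multiplier for [x] also serves [x * y] for every [y] in [J]. In particular the ring [E] of
    w-stability is w-closed. *)
Lemma w_op_colon I J : submodule I -> w_op (colon (w_op I) J) `<=` colon (w_op I) J.
Proof.
move=> sI x; have sw := w_op_submodule sI; have sc := colon_submodule J sw.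
move=> /(w_opP _ sc) h; apply/colonE => y Jy; rewrite -w_op_idem //.
apply/w_opP => // M tM; have [s ds /colonE hs] := h M tM.
by exists s => //; rewrite mulrA; exact: hs.
Qed.

(** For [x] outside [R], the denominator ideal [(R : x) `&` R] is a proper
    t-ideal, hence lies in some t-maximal ideal. *)
Lemma w_op_base : w_op base = base.
Proof.
have sb := base_submodule R.
apply/seteqP; split; last exact: w_op_sup.
move=> x /(w_opP _ sb) h; apply: contrapT => bx.
have [d d0 bd] := fraction_denom x.
pose A := [set z | base z /\ base (z * x)].
have pA : proper_t_ideal A.
  apply: (@proper_t_ideal_intro _ _ d%:F).
  - split=> [|z w [bz Mz] [bw Mw]|a z [bz Mz]].
    + by split; [exact: base0 | rewrite mul0r; exact: base0].
    + by split; [exact: baseD | rewrite mulrDl; exact: baseD].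
    + by split; rewrite -?mulrA; apply: baseM => //; exact: base_tofrac.
  - by move=> z [].
  - by move=> [_]; rewrite mul1r.
  - by split=> //; exact: base_tofrac.
  - by rewrite tofrac_eq0.
  move=> J _ _ JA z vz; split; first by apply: v_op_base vz => w /JA[].
  (* Since [J] lies in [A], [x] belongs to [colon base J], and [z] in [v_op J] sends it into
     [base]. *)
  by move/colonE: vz; apply; apply/colonE => w /JA[_]; rewrite mulrC.
have [M tM AM] := proper_t_ideal_t_Max pA.
by have [s [bs Ms] bsx] := h M tM; apply: Ms; exact: AM.
Qed.

Lemma w_op_sub_base I : submodule I -> I `<=` base -> w_op I `<=` base.
Proof.
by move=> sI Ib; rewrite -w_op_base; apply: w_op_mono => //; exact: base_submodule.
Qed.

End WOperation.

(** * Strong Mori domains: w-finiteness and the local unit argument *)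

Section StrongMori.
Variable R : idomainType.
Hypothesis hR : strong_Mori R.
Local Notation K := {fraction R}.
Local Notation base := (@base R).
Implicit Types (I J : set K) (x y : K).

(** Otherwise, adjoining again and again an element of [I] outside the w-closure of the current span
    yields a strictly ascending chain. *)
Lemma strong_Mori_w_finite I : is_ideal I ->
  exists s : seq K, [set` s] `<=` I /\ I `<=` w_op (span s).
Proof.
move=> [sI [x0 Ix0 x00] [d d0 dI]].
have d0F : d%:F != 0 by rewrite tofrac_eq0.
apply: contrapT => noS.
have step (s : seq K) : exists y, [set` s] `<=` I -> I y /\ ~ w_op (span s) y.
  apply: contrapT => noy; apply: noS; exists s.
  split; last move=> y Iy; apply: contrapT => h; apply: noy.
    (* When the list is not inside [I] the requirement on [y] is vacuous, and 0 is a default. *)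
    by exists 0.
  by exists y.
have [g gP] := choice step.
pose s := fix s n := if n is m.+1 then g (s m) :: s m else [:: x0].
have sS n : [set` s n] `<=` I.
  elim: n => [|n IH] y /=; rewrite inE; first by move=> /eqP ->.
  by move=> /orP[/eqP ->|/IH//]; have [] := gP _ IH.
(* The chain condition concerns integral ideals, so all spans are scaled by the common denominator
   [d]. *)
pose A n := idscale d%:F (span (s n)).
have sA n : submodule (A n) by exact/idscale_submodule/span_submodule.
have Ab n : A n `<=` base.
  by move=> _ [y /(span_sub sI (sS n)) /dI ? <-].
have Amono n : A n `<=` A n.+1.
  move=> _ [y sy <-]; exists y => //; move: y sy; apply: span_sub.
    exact: span_submodule.
  by move=> y ys; apply: mem_span; rewrite inE; apply/orP; right.
have A0 n : A n (d%:F * x0).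
  by elim: n => [|n /Amono//]; exists x0 => //; exact/mem_span/mem_head.
have [||N hN] := hR (I := fun n => w_op (A n)).
- move=> n; have iw := w_op_sub_base (sA n) (@Ab n); split=> //.
  split; last by rewrite w_op_idem.
  apply: (@integral_ideal _ _ (d%:F * x0)) => //; first exact: w_op_submodule.
    exact: w_op_sup.
  exact: mulf_neq0.
- by move=> n; exact: w_op_mono.
have [Ig ng] := gP _ (sS N); apply: ng.
have : w_op (A N) (d%:F * g (s N)).
  rewrite -(hN N.+1) //; apply: w_op_sup => //.
  by exists (g (s N)) => //; exact/mem_span/mem_head.
rewrite /A w_op_idscale //; last exact: span_submodule.
by move=> /(idscaleE _ _ d0F); rewrite mulKf.
Qed.

(** The core shared by the Clifford and the Boole case; two inclusions are assumed so that both
    fit. *)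
Lemma w_unit I J : is_ideal I -> submodule J ->
  I `<=` w_op (idmul (idmul I I) J) -> idmul (idmul I I) J `<=` w_op I ->
  w_op (idmul I J) 1.
Proof.
move=> iI sJ sub sup; have [sI [x0 Ix0 x00] _] := iI.
have sIJ : submodule (idmul I J) by exact: idmul_submodule.
have [s [sS Is]] := strong_Mori_w_finite iI.
have ss := span_submodule s.
set N := w_op (idmul I J); have sN : submodule N by exact: w_op_submodule.
(* For [a] in [idmul I J] and [c] in [I], [a * c] falls back into [w_op I] by [sup]; a further
   factor from [J] then lands in [N]. *)
have NM x y : N x -> N y -> N (x * y).
  move=> Nx Ny; suff : w_op (idmul (idmul I J) (idmul I J)) (x * y).
    apply: w_op_least => //; first exact: idmul_submodule.
    move=> {Nx Ny}; apply: idmul_sub; first exact: submodule_add.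
    move=> a + IJa; apply: idmul_sub.
      exact/add_closed_mul/submodule_add.
    move=> c e Ic Je /=; rewrite mulrA; apply: w_op_idmul => //.
    apply: idmul_prod; last exact: w_op_sup.
    move: a IJa; apply: (@idmul_sub _ _ _ [set a | w_op I (a * c)]).
      have [w0 wD _] := w_op_submodule sI.
      split=> [|a b' wa wb] /=; first by rewrite mul0r.
      by rewrite mulrDl; exact: wD.
    move=> a b' Ia Jb /=; apply: sup; rewrite mulrAC.
    by do 2?apply: idmul_prod.
  by apply: w_op_idmul => //; exact: idmul_prod.
rewrite -/N -[N]w_op_idem //; apply/w_opP => // M tM.
pose P := [set x | exists2 t, (base `\` M) t & N (t * x)].
have [_ _ NZ] := sN.
have PD : add_closed P by exact: local_add_closed.
have PN x : P x -> P (- x).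
  move=> [t dt Nx]; exists t => //; rewrite mulrN -mulN1r.
  by rewrite -tofrac1 -tofracN; exact: NZ.
have PM x y : P x -> P y -> P (x * y).
  move=> [t dt Nx] [u du Ny]; exists (t * u); first exact: t_Max_prime.
  by rewrite mulrACA; exact: NM.
have NP : N `<=` P by move=> x Nx; exists 1; rewrite ?mul1r //; exact: denom1.
(* [P] is [N] localized at [M]. Dividing by denominators lets every multiplier produced by [w_opP]
   be discarded. *)
have Pdiv t x : (base `\` M) t -> P x -> P (t^-1 * x).
  move=> dt [u du Nx]; exists (u * t); first exact: t_Max_prime.
  by rewrite -mulrA mulVKf //; exact: denom_neq0 dt.
have PIdiv t x : (base `\` M) t -> idmul P [set` s] (t * x) -> idmul P [set` s] x.
  move=> dt h; rewrite -[x](mulKf (denom_neq0 tM dt)); move: h.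
  by apply: idmulZ => y; exact: Pdiv.
suff : P 1 by case=> t dt; exists t.
apply: (@nakayama _ P PD PN PM s I 1) => //; first by rewrite subrr; case: PD.
  by exists x0.
move=> f /sub /(w_opP _ (idmul_submodule _ (idmul_submodule _ sI))) /(_ M tM).
move=> [t dt]; rewrite mul1r => h; apply: (PIdiv t) => //; move: (t * f) h.
apply: idmul_sub; first exact: idmul_add.
move=> x b + Jb; move: x.
apply: (@idmul_sub _ _ _ [set x | idmul P [set` s] (x * b)]).
  have [m0 mD] := idmul_add P [set` s].
  split=> [|x y hx hy] /=; first by rewrite mul0r.
  by rewrite mulrDl; exact: mD.
(* In [a * c * b], the factor [c] is expanded over the generators [s], while [a * b] serves as a
   coefficient in [P]. *)
move=> a c Ia /Is /(w_opP _ ss) /(_ M tM) [u du suc] /=.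
apply: (PIdiv u) => //; rewrite mulrAC mulrA [u * _]mulrC -mulrA.
move: (u * c) suc; rewrite spanE; apply: idmul_sub.
  exact/add_closed_mul/idmul_add.
move=> r y br ys /=; rewrite mulrA; apply: idmul_prod => //.
apply: NP; rewrite mulrC; apply: (submoduleZ sN) => //.
exact/w_op_sup/idmul_prod.
Qed.

(** * Clifford w-regularity and w-stability *)

Lemma colon_w_ideal I : is_ideal I ->
  is_ideal (colon (colon (w_op I) (w_op I)) (w_op I)).
Proof.
move=> [sI [x Ix x0] [d d0 dI]].
have sw := w_op_submodule sI.
have d0F : d%:F != 0 by rewrite tofrac_eq0.
have dw y : w_op I y -> base (d%:F * y).
  move=> wy; apply: (@w_op_sub_base _ (idscale d%:F I)).
  - exact: idscale_submodule.
  - by move=> _ [z /dI ? <-].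
  - by rewrite w_op_idscale //; exists y.
have [q _ qE] := dI x Ix.
split; first exact/colon_submodule/colon_submodule.
  (* [d] sends [w_op I] into [base], and elements of [base] act on [w_op I]. *)
  exists d%:F => //; apply/colonE => y /dw bdy; apply/colonE => z.
  exact: submoduleZ.
(* [q] is the element [d * x] of the ring. Since [c * x * x] lies in [w_op I], multiplying [c] by
   the square of [q] clears denominators. *)
exists (q * q).
  by rewrite -tofrac_eq0 tofracM qE !mulf_neq0.
have wx : w_op I x by exact: w_op_sup.
move=> c /colonE /(_ x wx) /colonE /(_ x wx) wc.
rewrite tofracM qE; have -> : d%:F * x * (d%:F * x) * c = d%:F * (d%:F * (c * x * x)).
  by ring.
by apply: baseM (base_tofrac d) _; exact: dw.
Qed.

Lemma clifford_w_stable I J : is_ideal I -> is_ideal J ->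
  w_op I = w_op (idmul (idmul I I) J) -> w_stable I.
Proof.
move=> iI [sJ _ _] wE; have [sI _ _] := iI; have sII := @idmul_submodule _ I I sI.
have sIIJ := @idmul_submodule _ _ J sII; have sIJ := @idmul_submodule _ I J sI.
have sw := w_op_submodule sI.
have : w_op (idmul I J) 1.
  by apply: w_unit => //; [rewrite -wE; exact: w_op_sup | rewrite wE; exact: w_op_sup].
rewrite /w_stable; set L := w_op I; set E := colon L L.
have sE : submodule E by exact: colon_submodule.
have sT : submodule (idmul L (colon E L)) by exact: idmul_submodule.
(* [E] is w-closed, and [a * b] sends [w_op I] into the w-closure of I I J, which is [w_op I]. *)
have IJE : w_op (idmul I J) `<=` E.
  apply: subset_trans (w_op_colon sI).
  apply: w_op_mono => //; apply: idmul_sub; first exact: submodule_add.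
  move=> a b Ia Jb; apply/colonE => y Ly.
  suff : w_op (idmul (idmul I I) J) (a * b * y) by rewrite -wE.
  rewrite mulrAC [a * y]mulrC.
  suff h : w_op (idmul I I) (y * a).
    by apply: w_op_idmul => //; apply: idmul_prod => //; exact: w_op_sup.
  by apply: w_op_idmul => //; apply: idmul_prod => //; exact: w_op_sup.
move=> one; apply/seteqP; split.
  apply: subset_trans (w_op_colon sI); apply: w_op_mono => //.
  apply: idmul_sub; first exact: submodule_add.
  by move=> a b La /colonE Eb; rewrite mulrC; exact: Eb.
move=> e Ee.
have : w_op (idmul L (colon E L)) 1.
  move: {e Ee} 1 one; apply: w_op_mono => //.
  apply: idmul_sub; first exact: submodule_add.
  move=> a b Ia Jb; apply: idmul_prod; first exact: w_op_sup.
  apply/colonE => y Ly; apply: IJE; rewrite mulrC; apply: w_op_idmul => //.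
  by apply: idmul_prod => //; exact: w_op_sup.
(* As [e] preserves [L], it preserves [idmul L (colon E L)], so a multiplier for 1 also works for
   [e]. *)
move=> /(w_opP _ sT) h; apply/w_opP => // M tM; have [s ds Ts] := h M tM.
exists s => //; rewrite mulrC -[s]mulr1; apply: idmulZ Ts => y Ly.
by move/colonE: Ee; exact.
Qed.

Lemma w_stable_clifford I : is_ideal I -> w_stable I -> clifford_w_regular I.
Proof.
move=> iI; have [sI _ _] := iI; have sII := @idmul_submodule _ I I sI.
have sw := w_op_submodule sI.
rewrite /w_stable; set L := w_op I; set E := colon L L => wE.
have iJ := colon_w_ideal iI; have [sJ _ _] := iJ.
exists (colon E L) => //; set J := colon E L in wE sJ *.
have sIIJ := @idmul_submodule _ _ J sII; have sLJ := @idmul_submodule _ L J sw.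
apply/seteqP; split; last first.
  apply: w_op_least => //; apply: idmul_sub; first exact: submodule_add.
  move=> + j + Jj; apply: idmul_sub.
    have [w0 wD _] := sw.
    split=> [|x y hx hy] /=; first by rewrite mul0r.
    by rewrite mulrDl; exact: wD.
  move=> a a' Ia Ia' /=; rewrite -mulrA mulrC.
  have La : L a by exact: w_op_sup.
  have La' : L a' by exact: w_op_sup.
  move/colonE: Jj => /(_ a' La') /colonE /(_ a La).
  by rewrite [a' * j]mulrC.
move=> y Ly.
(* By stability 1 is in the w-closure of [idmul L J]; writing [y] as [y * 1] brings in the second
   factor [L] and the factor [J]. *)
have : E 1 by apply/colonE => z; rewrite mul1r.
rewrite -wE -[y]mulr1 => one.
have : w_op (idmul I (idmul L J)) (y * 1).
  by apply: w_op_idmul => //; exact: idmul_prod.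
apply: w_op_least => //; first exact: idmul_submodule.
apply: idmul_sub; first exact/submodule_add/w_op_submodule.
move=> a + Ia; apply: idmul_sub; first exact/add_closed_mul/submodule_add/w_op_submodule.
move=> l j Ll Jj /=; rewrite mulrA; apply: w_op_idmul => //.
apply: idmul_prod; last exact: w_op_sup.
by apply: w_op_idmul => //; apply: idmul_prod => //; exact: w_op_sup.
Qed.

(** * Boole w-regularity and strong w-stability *)

Lemma boole_strongly_w_stable I :
  is_ideal I -> boole_w_regular I -> strongly_w_stable I.
Proof.
move=> iI [x x0 wE]; have [sI _ _] := iI; have sII := @idmul_submodule _ I I sI.
have sw := w_op_submodule sI.
pose J := idscale x^-1 base.
have xV0 : x^-1 != 0 by rewrite invr_eq0.
have sJ : submodule J by exact/idscale_submodule/base_submodule.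
have Lx y z : w_op I y -> w_op I z -> w_op I (x^-1 * (y * z)).
  move=> Ly Lz; apply/idscaleE => //; rewrite -wE.
  by apply: w_op_idmul => //; exact: idmul_prod.
have sIIJ := @idmul_submodule _ _ J sII.
have JxV : J x^-1 by exists 1; [exact: base1 | rewrite mulr1].
have one : w_op (idmul I J) 1.
  apply: w_unit => //.
    move=> a Ia; have : w_op (idmul I I) (x * a).
      by rewrite wE; exists a => //; exact: w_op_sup.
    move=> /(w_opP _ sII) h; apply/w_opP => // M tM.
    have [s ds sa] := h M tM; exists s => //.
    have -> : s * a = s * (x * a) * x^-1 by rewrite [x * a]mulrC mulrA mulfK.
    exact: idmul_prod.
  apply: idmul_sub; first exact: submodule_add.
  move=> y _ Iy [r br <-]; rewrite mulrA mulrC; apply: (submoduleZ sw) => //.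
  rewrite mulrC; apply/idscaleE => //; rewrite -wE.
  exact: w_op_sup.
(* [idmul I J] lies in [idscale x^-1 I], so 1 is in the w-closure of the latter; scaling by [x]
   gives the claim. *)
have Lx1 : w_op I x.
  have : w_op (idscale x^-1 I) 1.
    have sxI := idscale_submodule x^-1 sI.
    move: 1 one; apply: w_op_mono => //; first exact: idmul_submodule.
    apply: idmul_sub; first exact: submodule_add.
    move=> a _ Ia [r br <-]; exists (r * a); first exact: submoduleZ.
    by rewrite mulrA mulrC.
  by rewrite w_op_idscale // => /idscaleE; rewrite invrK mulr1; apply.
(* By [Lx], [x^-1 * y] preserves [w_op I]; conversely [E] sends [x] into [w_op I] by [Lx1]. *)
exists x; apply/seteqP; split=> y.
  by move=> Ly; apply/idscaleE => //; apply/colonE => z Lz; rewrite -mulrA; exact: Lx.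
by move=> [e /colonE Ee <-]; rewrite mulrC; exact: Ee.
Qed.

Lemma strongly_w_stable_boole I :
  is_ideal I -> strongly_w_stable I -> boole_w_regular I.
Proof.
move=> [sI [x0 Ix0 x00] _] [x wE].
have sII := @idmul_submodule _ I I sI.
have sw := w_op_submodule sI.
have nzx : x != 0.
  have : w_op I x0 by exact: w_op_sup.
  rewrite wE => -[e _ xe]; apply/eqP => xz; move: x00.
  by rewrite -xe xz mul0r eqxx.
exists x => //; apply/seteqP; split.
  rewrite -w_op_idscale //.
  apply: w_op_least => //; first exact: idscale_submodule.
  rewrite w_op_idscale //.
  apply: idmul_sub; first exact/submodule_add/idscale_submodule.
  move=> a a' /(w_op_sup sI) + /(w_op_sup sI) La'.
  (* Only one of the two factors is written as [x * e]; [e] then acts on the other. *)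
  rewrite {1}wE => -[e /colonE Ee <-]; exists (e * a'); first exact: Ee.
  by rewrite mulrA.
move=> _ [y Ly <-]; apply: w_op_idmul => //; apply: idmul_prod => //.
(* Since 1 is in [E], [x] itself lies in [w_op I]. *)
rewrite wE; exists 1; last by rewrite mulr1.
by apply/colonE => z; rewrite mul1r.
Qed.

End StrongMori.

Theorem corollary3p11 (R : idomainType) (hR : strong_Mori R) :
  (clifford_w_regular_domain R <-> w_stable_domain R) /\
  (boole_w_regular_domain R <-> strongly_w_stable_domain R).
Proof.
split; split=> h I iI.
- by have [J iJ] := h I iI; exact: clifford_w_stable.
- exact/w_stable_clifford/h.
- exact/boole_strongly_w_stable/h.
- exact/strongly_w_stable_boole/h.
Qed.
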